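(* Let $R$ be a root system in $\mathbb{R}^n$ with positive subsystem $R_+$ and Weyl group $W$, let $k:R\to[0,\infty)$ be $W$-invariant, and let $C=\{x\in\mathbb{R}^n:x\cdot\alpha>0\ \text{for all }\alpha\in R_+\}$. For $x\in C$ define $$\delta(x):=\prod_{\alpha\in R_+}(\alpha\cdot x)^{1-2k(\alpha)}.$$ Then $\delta$ is harmonic in $C$ for the operator $$\mathcal{L}^W_ku(x)=\frac12\Delta u(x)+\sum_{\alpha\in R_+}k(\alpha)\frac{\nabla u(x)\cdot\alpha}{x\cdot\alpha},$$ i.e. $\mathcal{L}^W_k\delta(x)=0$ for every $x\in C$.
   Context: A root system is a finite set $R\subset\mathbb{R}^n\setminus\{0\}$ with $R\cap\mathbb{R}\alpha=\{\pm\alpha\}$ and $\sigma_\alpha(R)=R$ for all $\alpha\in R$, where $\sigma_\alpha$ is the orthogonal reflection in the hyperplane $H_\alpha=\alpha^\perp$. Roots are normalized by $\alpha\cdot\alpha=2$, so $\sigma_\alpha(x)=x-(\alpha\cdot x)\alpha$. The (finite) Weyl group $W$ is generated by $\{\sigma_\alpha:\alpha\in R\}$. A positive subsystem is $R_+=\{\alpha\in R:\alpha\cdot\beta>0\}$ for some $\beta\notin\bigcup_{\alpha\in R}H_\alpha$. $k:R\to[0,\infty)$ is $W$-invariant if $k(w\alpha)=k(\alpha)$ for all $w\in W$, $\alpha\in R$. *)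

(* Defs.v *)
From HB Require Import structures.
From mathcomp Require Import all_boot all_order all_algebra finmap.
From mathcomp Require Import all_classical all_reals all_analysis.
Set Implicit Arguments.
Unset Strict Implicit.
Unset Printing Implicit Defensive.
Import Order.TTheory GRing.Theory Num.Theory.
Import numFieldNormedType.Exports.
Local Open Scope classical_set_scope.
Local Open Scope ring_scope.

(* The topology on 'rV[R]_n is that of the sup norm, hence the Euclidean one;
   the norm itself is not used, only the dot product below. *)

Definition dot {R : realType} {n : nat} (u v : 'rV[R]_n) : R :=
  (u *m v^T) 0 0.

Definition reflection {R : realType} {n : nat} (a x : 'rV[R]_n) : 'rV[R]_n :=
  x - (2 * dot a x / dot a a) *: a.

Definition root_system {R : realType} {n : nat} (Phi : {fset 'rV[R]_n}) : Prop :=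
  [/\ 0 \notin Phi,
      forall a, a \in Phi ->
        [set` Phi] `&` [set c *: a | c in [set: R]] = [set a; - a]
    & forall a, a \in Phi -> reflection a @` [set` Phi] = [set` Phi] ].

Definition normalized {R : realType} {n : nat} (Phi : {fset 'rV[R]_n}) : Prop :=
  forall a, a \in Phi -> dot a a = 2.

Lemma reflectionE {R : realType} {n : nat} (Phi : {fset 'rV[R]_n}) :
  normalized Phi ->
  forall a, a \in Phi -> forall x, reflection a x = x - dot a x *: a.
Proof.
move=> nPhi a aPhi x; rewrite /reflection (nPhi a aPhi).
by rewrite mulrC mulrA mulVf ?mul1r// pnatr_eq0.
Qed.

Definition transformation_group {T : Type} (G : set (T -> T)) : Prop :=
  [/\ G id,
      forall f g, G f -> G g -> G (f \o g)
    & forall f g, G f -> cancel f g -> cancel g f -> G g].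

Definition weyl_group {R : realType} {n : nat} (Phi : {fset 'rV[R]_n}) :
    set ('rV[R]_n -> 'rV[R]_n) :=
  smallest transformation_group [set reflection a | a in [set` Phi]].

Definition positive_subsystem {R : realType} {n : nat}
    (Phi Phip : {fset 'rV[R]_n}) : Prop :=
  exists2 b : 'rV[R]_n, (forall a, a \in Phi -> dot a b != 0) &
    Phip = [fset a in Phi | 0 < dot a b]%fset.

(* A multiplicity function is represented by a total function on R^n; only its
   values on Phi matter. *)
Definition weyl_invariant {R : realType} {n : nat} (Phi : {fset 'rV[R]_n})
    (k : 'rV[R]_n -> R) : Prop :=
  forall w a, weyl_group Phi w -> a \in Phi -> k (w a) = k a.

Definition chamber {R : realType} {n : nat} (Phip : {fset 'rV[R]_n}) :
    set 'rV[R]_n :=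
  [set x | forall a, a \in Phip -> 0 < dot x a].

Definition partial {R : realType} {n : nat} (i : 'I_n) (u : 'rV[R]_n -> R) :
    'rV[R]_n -> R :=
  fun x => 'D_(delta_mx 0 i) u x.

Definition gradient {R : realType} {n : nat} (u : 'rV[R]_n -> R)
    (x : 'rV[R]_n) : 'rV[R]_n :=
  \row_i partial i u x.

Definition laplacian {R : realType} {n : nat} (u : 'rV[R]_n -> R)
    (x : 'rV[R]_n) : R :=
  \sum_(i < n) partial i (partial i u) x.

Definition dunkl_laplacian {R : realType} {n : nat} (Phip : {fset 'rV[R]_n})
    (k : 'rV[R]_n -> R) (u : 'rV[R]_n -> R) (x : 'rV[R]_n) : R :=
  2^-1 * laplacian u x
  + \sum_(a <- Phip) k a * (dot (gradient u x) a / dot x a).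

(* Class C^2 on an open set D. *)
Definition C2_on {R : realType} {n : nat} (D : set 'rV[R]_n)
    (u : 'rV[R]_n -> R) : Prop :=
  forall x, D x ->
    {for x, continuous u} /\
    forall i : 'I_n,
      [/\ derivable u x (delta_mx 0 i),
          {for x, continuous (partial i u)}
        & forall j : 'I_n,
            derivable (partial i u) x (delta_mx 0 j) /\
            {for x, continuous (partial j (partial i u))}].

(* 'D_v u x is a total operator with an unspecified value where u is not
   derivable, so L u = 0 is only meaningful together with regularity of u. *)
Definition harmonic_on {R : realType} {n : nat}
    (L : ('rV[R]_n -> R) -> 'rV[R]_n -> R) (D : set 'rV[R]_n)
    (u : 'rV[R]_n -> R) : Prop :=
  C2_on D u /\ forall x, D x -> L u x = 0.

Definition delta {R : realType} {n : nat} (Phip : {fset 'rV[R]_n})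
    (k : 'rV[R]_n -> R) (x : 'rV[R]_n) : R :=
  \prod_(a <- Phip) (dot a x `^ (1 - 2 * k a)).

(* Main.v *)
(* Write c = 1 - 2k and let A_a denote dot a x.  The gradient of delta is delta
   times the sum of (c a / A_a) a, so that L delta / delta reduces to
     1/2 sum_(a, b in R+) c b (a.b) / (A_a A_b) - sum_(a in R+) c a / A_a^2.
   The diagonal of the double sum cancels the second sum.  The rest vanishes: by
   evenness it is a sum over non-proportional pairs of roots (b, a) in R, and
   c b may be replaced with (c a + c b) / 2.  If u and u + phi are the angles of
   b and a with the projection of x to their plane, then
     1 / (cos u cos (u + phi)) = (tan (u + phi) - tan u) / sin phi,
   and rotating the pair by phi maps (b, a) to (a, - reflection a b), which is
   again a pair of roots with the same a.b and the same c a + c b.  So the sum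
   telescopes along the orbits of this permutation of the pairs of roots. *)
Require Import Defs.
From mathcomp Require Import all_boot all_order all_algebra finmap.
From mathcomp Require Import all_classical all_reals all_analysis.
From mathcomp Require Import ring lra.
Local Open Scope ring_scope.

Import Order.TTheory GRing.Theory Num.Theory.
Import numFieldNormedType.Exports.
Local Open Scope classical_set_scope.

Set Implicit Arguments.
Unset Strict Implicit.
Unset Printing Implicit Defensive.

(** * The tangent difference formula as a rational identity *)

Section TanTelescope.
Context {R : realFieldType}.
Implicit Types A B t c d : R.

Lemma disc_gt0 A B t : B != 0 -> 0 < 4 - t ^+ 2 ->
  0 < A ^+ 2 + B ^+ 2 - t * A * B.
Proof.
move=> B0 t4.
rewrite (_ : _ - _ = (A - t * B / 2) ^+ 2 + (4 - t ^+ 2) * B ^+ 2 / 4).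
  by rewrite ltr_wpDl ?sqr_ge0 // divr_gt0 // mulr_gt0 // exprn_even_gt0.
by field.
Qed.

(** Over the reals, put [A] = r cos (u + phi), [B] = r cos u and [t] = 2 cos phi. Then
    [A / B - t / 2] is - sin phi tan u, and both long denominators equal (r sin phi)^2. The
    unreduced [t * 2 - t] is the dot product of the rotated pair as bilinearity produces it. *)
Lemma tan_telescope A B t c d : A != 0 -> B != 0 -> 0 < 4 - t ^+ 2 ->
  - ((d + c) * (t * 2 - t) /
     ((t * A - B) ^+ 2 + A ^+ 2 - (t * 2 - t) * (t * A - B) * A))
  * ((t * A - B) / A - (t * 2 - t) / 2)
  - - ((c + d) * t / (A ^+ 2 + B ^+ 2 - t * A * B)) * (A / B - t / 2) =
  (c + d) * t / (A * B).
Proof.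
move=> A0 B0 t4; have /lt0r_neq0 D0 := disc_gt0 A B0 t4.
have -> : t * 2 - t = t by ring.
have -> : (t * A - B) ^+ 2 + A ^+ 2 - t * (t * A - B) * A =
          A ^+ 2 + B ^+ 2 - t * A * B by ring.
by field; rewrite A0 B0 D0.
Qed.

End TanTelescope.

(** * Bilinearity of the dot product and Cauchy-Schwarz for vectors of square norm 2 *)

Section DotProduct.
Context {R : realType} {n : nat}.
Implicit Types (u v w : 'rV[R]_n) (a : R).

Lemma dotE u v : dot u v = \sum_i u 0 i * v 0 i.
Proof. by rewrite /dot mxE; apply: eq_bigr => i _; rewrite mxE. Qed.

Lemma dotC u v : dot u v = dot v u.
Proof. by rewrite !dotE; apply: eq_bigr => i _; rewrite mulrC. Qed.

Lemma dotDl u v w : dot (u + v) w = dot u w + dot v w.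
Proof. by rewrite /dot mulmxDl mxE. Qed.

Lemma dotDr u v w : dot w (u + v) = dot w u + dot w v.
Proof. by rewrite dotC dotDl !(dotC w). Qed.

Lemma dotZl a u w : dot (a *: u) w = a * dot u w.
Proof. by rewrite /dot -scalemxAl mxE. Qed.

Lemma dotZr a u w : dot w (a *: u) = a * dot w u.
Proof. by rewrite dotC dotZl dotC. Qed.

Lemma dotNl u w : dot (- u) w = - dot u w.
Proof. by rewrite -scaleN1r dotZl mulN1r. Qed.

Lemma dotNr u w : dot w (- u) = - dot w u.
Proof. by rewrite dotC dotNl dotC. Qed.

Lemma dotBl u v w : dot (u - v) w = dot u w - dot v w.
Proof. by rewrite dotDl dotNl. Qed.

Lemma dotBr u v w : dot w (u - v) = dot w u - dot w v.
Proof. by rewrite dotDr dotNr. Qed.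

Lemma dot_ge0 u : 0 <= dot u u.
Proof. by rewrite dotE sumr_ge0 // => i _; rewrite -expr2 sqr_ge0. Qed.

Lemma dot_eq0 u : dot u u = 0 -> u = 0.
Proof.
rewrite dotE => /psumr_eq0P u0; apply/rowP => i; rewrite mxE.
by apply/eqP; rewrite -sqrf_eq0 expr2 u0 // => j _; rewrite -expr2 sqr_ge0.
Qed.

Lemma dot_delta u i : dot u (delta_mx 0 i) = u 0 i.
Proof.
rewrite dotE (bigD1 i) //= big1 ?addr0 => [|j /negPf ji].
  by rewrite mxE !eqxx mulr1.
by rewrite mxE ji andbF mulr0.
Qed.

Lemma sum_dot_delta u v :
  \sum_i dot u (delta_mx 0 i) * dot v (delta_mx 0 i) = dot u v.
Proof. by rewrite dotE; apply: eq_bigr => i _; rewrite !dot_delta. Qed.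

Lemma dot_sqr_le4 u v : dot u u = 2 -> dot v v = 2 -> dot u v ^+ 2 <= 4.
Proof.
move=> uu vv; have := dot_ge0 (u + v); have := dot_ge0 (u - v).
rewrite !(dotBl, dotBr, dotDl, dotDr) uu vv (dotC v u) => h1 h2; nra.
Qed.

(** The equality case of Cauchy-Schwarz: a dot product of 2 or -2 makes [u - v] or [u + v] of norm
    0. It singles out the proportional pairs of roots. *)
Lemma dot_sqr_eq4 u v : dot u u = 2 -> dot v v = 2 ->
  (dot u v ^+ 2 == 4) = (u == v) || (u == - v).
Proof.
move=> uu vv; apply/idP/orP => [|[]/eqP uE].
- rewrite (_ : 4 = 2 ^+ 2); last by ring.
  rewrite eqf_sqr => /orP[]/eqP uv; [left|right]; apply/eqP.
  + apply/subr0_eq/dot_eq0.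
    rewrite !(dotBl, dotBr) uu vv (dotC v u) uv; ring.
  + apply/subr0_eq/dot_eq0.
    rewrite opprK !(dotDl, dotDr) uu vv (dotC v u) uv; ring.
- by rewrite uE vv; apply/eqP; ring.
- by rewrite uE dotNl vv; apply/eqP; ring.
Qed.

End DotProduct.

(** * Rotation of pairs of roots *)

Section RootSystem.
Context {R : realType} {n : nat} (Phi : {fset 'rV[R]_n}).
Hypotheses (Phi_root : root_system Phi) (Phi_norm : normalized Phi).
Implicit Types a b x : 'rV[R]_n.

Lemma root_opp a : a \in Phi -> - a \in Phi.
Proof.
case: Phi_root => _ + _ aPhi => /(_ _ aPhi) /seteqP[_].
by move=> /(_ (- a)) [|//]; right.
Qed.

Lemma root_reflection a b : a \in Phi -> b \in Phi -> reflection a b \in Phi.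
Proof.
case: Phi_root => _ _ + aPhi bPhi => /(_ _ aPhi) /seteqP[+ _].
by apply; exists b.
Qed.

Lemma weyl_group_reflection a : a \in Phi -> weyl_group Phi (reflection a).
Proof. by move=> aPhi; apply: sub_gen_smallest; exists a. Qed.

(** A root is sent to its opposite by its own reflection. *)
Lemma invariant_opp (c : 'rV[R]_n -> R) a :
  weyl_invariant Phi c -> a \in Phi -> c (- a) = c a.
Proof.
move=> c_inv aPhi; rewrite -(c_inv _ _ (weyl_group_reflection aPhi) aPhi).
rewrite (reflectionE Phi_norm) // (Phi_norm aPhi) scaler_nat mulr2n opprD addrA.
by rewrite subrr add0r.
Qed.

(* In the plane of [b] and [a], rotates the pair by the angle from [b] to [a]:
   the second component is minus the reflection of [b] in the hyperplane of
   [a]. *)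
Definition rotate_pair (p : 'rV[R]_n * 'rV[R]_n) : 'rV[R]_n * 'rV[R]_n :=
  (p.2, dot p.2 p.1 *: p.2 - p.1).

Lemma rotate_pair_root b a : a \in Phi -> b \in Phi ->
  dot a b *: a - b \in Phi.
Proof.
move=> aPhi bPhi; rewrite -opprB -(reflectionE Phi_norm) //.
by rewrite root_opp ?root_reflection.
Qed.

Lemma rotate_pair_inj : {in [pred p | p.1 \in Phi & p.2 \in Phi] &,
  injective rotate_pair}.
Proof.
move=> [b a] [b' a'] /= /andP[bP aP] /andP[b'P a'P] [aa'].
rewrite -{}aa' => e.
(* Since [dot a a] is 2, the dot product of [a] with [dot a b *: a - b] is again [dot a b]; this
   scalar is therefore recovered first, and [b] after it. *)
have /(congr1 (dot a)) := e.
rewrite !(dotBr, dotZr) (Phi_norm aP) => d.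
have dd : dot a b = dot a b' by lra.
by move: e; rewrite dd => /addrI /oppr_inj ->.
Qed.

(** An injective map from a finite set to itself is a permutation, so it only reindexes the sum. *)
Lemma sum_rotate_pair (F : 'rV[R]_n * 'rV[R]_n -> R) :
  \sum_(b <- Phi) \sum_(a <- Phi) F (rotate_pair (b, a)) =
  \sum_(b <- Phi) \sum_(a <- Phi) F (b, a).
Proof.
rewrite -!(big_allpairs (op := +%R) (F := fun p => F (rotate_pair p))).
rewrite -(big_allpairs (op := +%R) (F := F)).
pose s := [seq (b, a) | b <- Phi, a <- Phi].
rewrite -/s -(big_map rotate_pair predT F); apply: perm_big.
have sP p : (p \in s) = (p.1 \in Phi) && (p.2 \in Phi).
  case: p => b a; apply/allpairsP/andP => /= [[[b' a'] [? ? [-> ->]]] //|[? ?]].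
  by exists (b, a).
have s_uniq : uniq s by rewrite allpairs_uniq ?fset_uniq // => -[? ?] [? ?].
have s'_uniq : uniq (map rotate_pair s).
  rewrite map_inj_in_uniq // => p q; rewrite !sP => pP qP.
  exact: rotate_pair_inj.
have sub_s : {subset map rotate_pair s <= s}.
  move=> _ /mapP[[b a] + ->]; rewrite !sP /= => /andP[bP aP].
  by rewrite aP rotate_pair_root.
rewrite perm_sym; apply: uniq_perm => //.
have [|_ e p] := uniq_min_size s'_uniq sub_s; first by rewrite size_map.
by rewrite e.
Qed.

(** * The telescoping sum over all pairs of roots *)

Section PairSum.
Context (c : 'rV[R]_n -> R) (x : 'rV[R]_n).
Hypotheses (c_inv : weyl_invariant Phi c)
  (x_regular : forall a, a \in Phi -> dot a x != 0).

(** The weight is symmetrized because [c a + c b] is preserved by [rotate_pair], whereas [c b] alone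
    would become [c a]. *)
Definition pair_term (b a : 'rV[R]_n) : R :=
  (c a + c b) * dot a b / (dot a x * dot b x).

(* A multiple of the tangent of the angle between [b] and the projection of [x]
   to the plane of [b] and [a]; the factor is constant along the orbits of
   [rotate_pair]. *)
Definition pair_tan (p : 'rV[R]_n * 'rV[R]_n) : R :=
  let: (b, a) := p in let t := dot a b in
  - ((c a + c b) * t / (dot a x ^+ 2 + dot b x ^+ 2 - t * dot a x * dot b x))
  * (dot a x / dot b x - t / 2).

Lemma pair_term_telescope b a : a \in Phi -> b \in Phi ->
  pair_tan (rotate_pair (b, a)) - pair_tan (b, a) =
  if dot a b ^+ 2 == 4 then 0 else pair_term b a.
Proof.
move=> aP bP; have Ax := x_regular aP; have Bx := x_regular bP.
(* The rotated root is, up to sign, the image of [b] under a reflection of the Weyl group. *)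
have c_rot : c (dot a b *: a - b) = c b.
  rewrite -opprB -(reflectionE Phi_norm) // invariant_opp ?root_reflection //.
  by rewrite c_inv //; apply: weyl_group_reflection.
rewrite /rotate_pair /pair_tan /pair_term /= c_rot.
rewrite !(dotBl, dotZl) (Phi_norm aP) (dotC b a).
have Rx : dot a b * dot a x - dot b x != 0.
  by rewrite -dotZl -dotBl x_regular ?rotate_pair_root.
have t4 := dot_sqr_le4 (Phi_norm aP) (Phi_norm bP).
have [t4E|tn4] := ifPn.
  (* Here [a = b] or [a = - b], and both tangents are 0 since x / 0 = 0. *)
  have := t4E; rewrite dot_sqr_eq4 ?Phi_norm // => abE.
  have AB0 : dot a x ^+ 2 + dot b x ^+ 2 = dot a b * dot a x * dot b x.
    by case/orP: abE => /eqP ->; rewrite ?dotNl Phi_norm //; ring.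
  have -> : (dot a b * dot a x - dot b x) ^+ 2 + dot a x ^+ 2
      - (dot a b * 2 - dot a b) * (dot a b * dot a x - dot b x) * dot a x =
      dot a x ^+ 2 + dot b x ^+ 2 - dot a b * dot a x * dot b x by ring.
  by rewrite AB0 subrr invr0 !mulr0 oppr0 !mul0r subrr.
have {t4} t4 : 0 < 4 - dot a b ^+ 2 by rewrite subr_gt0 lt_neqAle tn4.
exact: tan_telescope.
Qed.

Lemma pair_termNl b a : b \in Phi -> pair_term (- b) a = pair_term b a.
Proof.
move=> bP; rewrite /pair_term (invariant_opp c_inv bP) dotNr dotNl.
by rewrite !mulrN invrN mulNr mulrN opprK.
Qed.

Lemma pair_termNr b a : a \in Phi -> pair_term b (- a) = pair_term b a.
Proof.
move=> aP; rewrite /pair_term (invariant_opp c_inv aP) !dotNl.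
by rewrite mulrN !mulNr invrN mulrN opprK.
Qed.

Lemma pair_term_diag b : b \in Phi ->
  pair_term b b = 4 * (c b / dot b x ^+ 2).
Proof.
move=> bP; have Bx := x_regular bP.
by rewrite /pair_term (Phi_norm bP); field.
Qed.

(** The non-proportional pairs telescope to 0. For each [b] only [a = b] and [a = - b] remain, and
    by evenness each gives the diagonal value 4 [c b / dot b x ^+ 2], hence the factor 8. *)
Lemma sum_pair_term_root :
  \sum_(b <- Phi) \sum_(a <- Phi) pair_term b a =
  8 * \sum_(b <- Phi) c b / dot b x ^+ 2.
Proof.
have tel0 : \sum_(b <- Phi) \sum_(a <- Phi)
    (if dot a b ^+ 2 == 4 then 0 else pair_term b a) = 0.
  transitivity (\sum_(b <- Phi) \sum_(a <- Phi) pair_tan (rotate_pair (b, a))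
      - \sum_(b <- Phi) \sum_(a <- Phi) pair_tan (b, a)).
    rewrite -sumrB big_seq [RHS]big_seq; apply: eq_bigr => b bP.
    rewrite -sumrB big_seq [RHS]big_seq; apply: eq_bigr => a aP.
    by rewrite pair_term_telescope.
  by rewrite sum_rotate_pair subrr.
(* Subtracting the vanishing sum cancels every term except those with [dot a b ^+ 2 == 4]. *)
rewrite -[LHS]subr0 -[X in _ - X]tel0 -sumrB mulr_sumr big_seq [RHS]big_seq.
apply: eq_bigr => b bP; rewrite -sumrB.
have NbP := root_opp bP.
have bNb : - b != b.
  apply/eqP => /(congr1 (dot b)); rewrite dotNr (Phi_norm bP) => ?; lra.
rewrite (bigD1_seq b) ?fset_uniq //=.
rewrite big_mkcond (bigD1_seq (- b)) ?fset_uniq //= bNb.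
rewrite big_seq_cond big1 => [|a /andP[aP aNb]].
  rewrite !dot_sqr_eq4 ?Phi_norm // !eqxx orbT /= !subr0 addr0.
  by rewrite pair_termNr // pair_term_diag //; ring.
case: ifPn => // ab.
by rewrite dot_sqr_eq4 ?Phi_norm // (negPf aNb) (negPf ab) subrr.
Qed.


End PairSum.

(** * Passage from all roots to the positive ones *)

Context (Phip : {fset 'rV[R]_n}).
Hypothesis Phip_pos : positive_subsystem Phi Phip.

Lemma positive_root a : a \in Phip -> a \in Phi.
Proof. by case: Phip_pos => v _ ->; rewrite !inE => /andP[]. Qed.

Lemma root_pos_or_neg a : a \in Phi -> a \in Phip \/ - a \in Phip.
Proof.
case: Phip_pos => v v_reg -> aP; have := v_reg a aP.
rewrite neq_lt => /orP[v_lt|v_gt]; [right|left]; last by rewrite !inE aP.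
by rewrite !inE root_opp //= dotNl oppr_gt0.
Qed.

(** [Phi] is the disjoint union of [Phip] and its opposite. *)
Lemma sum_even_root (f : 'rV[R]_n -> R) :
  (forall a, a \in Phi -> f (- a) = f a) ->
  \sum_(a <- Phi) f a = 2 * \sum_(a <- Phip) f a.
Proof.
move=> f_even.
have -> : \sum_(a <- Phi) f a =
    \sum_(a <- (Phip : seq _) ++ map -%R (Phip : seq _)) f a.
  apply/perm_big/uniq_perm; rewrite ?fset_uniq //.
    rewrite cat_uniq fset_uniq map_inj_uniq ?fset_uniq ?andbT; last first.
      exact: oppr_inj.
    apply/hasPn => _ /mapP[a + ->].
    case: Phip_pos => v _ ->; rewrite !inE => /andP[_ av].
    by rewrite dotNl oppr_gt0 lt_gtF ?andbF.
  move=> a; rewrite mem_cat.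
  apply/idP/orP => [/root_pos_or_neg[|aP]|[|/mapP[b + ->]]].
  - by left.
  - by right; apply/mapP; exists (- a); rewrite ?opprK.
  - exact: positive_root.
  - by move=> /positive_root; exact: root_opp.
rewrite big_cat big_map /= mulr2n mulrDl !mul1r; congr (_ + _).
rewrite big_seq [RHS]big_seq; apply: eq_bigr => a /positive_root.
exact: f_even.
Qed.

(** Evenness in each variable turns the sum over [Phi] into 4 times the one over [Phip], and the
    right side doubles as well, so the positive pair terms add up to [4 * S]. Their sum is also
    twice the left side. *)
Lemma sum_pair_positive (c : 'rV[R]_n -> R) x : weyl_invariant Phi c ->
  (forall a, a \in Phip -> dot a x != 0) ->
  \sum_(a <- Phip) \sum_(b <- Phip) c b * (dot a b / (dot a x * dot b x)) =
  2 * \sum_(a <- Phip) c a / dot a x ^+ 2.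
Proof.
move=> c_inv x_pos.
have x_regular a : a \in Phi -> dot a x != 0.
  by move=> /root_pos_or_neg[/x_pos|/x_pos] //; rewrite dotNl oppr_eq0.
have := sum_pair_term_root c_inv x_regular.
rewrite sum_even_root => [|b bP]; last first.
  by apply: eq_bigr => a _; rewrite pair_termNl.
have even_r b : \sum_(a <- Phi) pair_term c x b a =
    2 * \sum_(a <- Phip) pair_term c x b a.
  by rewrite sum_even_root // => a aP; rewrite pair_termNr.
under eq_bigr do rewrite even_r.
rewrite -mulr_sumr.
rewrite [in RHS]sum_even_root => [|b bP]; last first.
  by rewrite (invariant_opp c_inv bP) dotNl sqrrN.
set S := \sum_(a <- Phip) c a / _.
set P := (X in X = 2 * S).
(* Undoes the symmetrization: exchanging the two summations in one copy of [P] gives the [c a] half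
   of [pair_term]. *)
have -> : \sum_(b <- Phip) \sum_(a <- Phip) pair_term c x b a = P + P.
  rewrite [X in _ = X + _]exchange_big -big_split; apply: eq_bigr => b _ /=.
  rewrite -big_split /=; apply: eq_bigr => a _.
  by rewrite /pair_term (dotC b a) (mulrC (dot b x)); ring.
lra.
Qed.

End RootSystem.

(** * Directional derivatives and continuity tools *)

Section DirectionalDerivatives.
Context {R : realType}.

(** Restricting to a line reduces directional derivatives to one real variable, where the usual
    chain rule applies. *)
Lemma is_derive_line (V : normedModType R) (g : V -> R) (x v : V) (b : R) :
  is_derive x v g b <->
  is_derive (0 : R) (1 : R) (fun t : R => g (t *: v + x)) b.
Proof.
have E : (fun h : R => h^-1 *: (g (h *: v + x) - g x)) =
    (fun h : R => h^-1 *: (g ((h *: 1 + 0 : R) *: v + x) -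
                           g ((0 : R) *: v + x))).
  by apply/funext => h; rewrite addr0 scale0r add0r [h *: 1]mulr1.
split=> -[gd <-]; apply: DeriveDef.
- by move: gd; rewrite /derivable E.
- by rewrite /derive E.
- by rewrite /derivable E.
- by rewrite /derive E.
Qed.

Lemma is_derive_comp_scalar (V : normedModType R) (f : R -> R) (g : V -> R)
    (x v : V) (a b : R) :
  is_derive (g x) 1 f a -> is_derive x v g b -> is_derive x v (f \o g) (a * b).
Proof.
move=> fa /is_derive_line gb; apply/is_derive_line.
apply: (is_derive1_comp (g := fun t : R => g (t *: v + x))) => //.
by rewrite ?scale0r ?add0r.
Qed.

Lemma sum_continuous_at (T : topologicalType) (I : eqType) (r : seq I)
    (F : I -> T -> R) (x : T) :
  (forall i, i \in r -> {for x, continuous (F i)}) ->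
  {for x, continuous (fun y => \sum_(i <- r) F i y)}.
Proof.
elim: r => [_|i r IH F_cont]; rewrite /prop_for /=.
  by under eq_fun do rewrite big_nil; exact: cvg_cst.
under eq_fun do rewrite big_cons.
apply: cvgD; first by apply: F_cont; rewrite mem_head.
by apply: IH => j jr; apply: F_cont; rewrite inE jr orbT.
Qed.

Lemma prod_continuous_at (T : topologicalType) (I : eqType) (r : seq I)
    (F : I -> T -> R) (x : T) :
  (forall i, i \in r -> {for x, continuous (F i)}) ->
  {for x, continuous (fun y => \prod_(i <- r) F i y)}.
Proof.
elim: r => [_|i r IH F_cont]; rewrite /prop_for /=.
  by under eq_fun do rewrite big_nil; exact: cvg_cst.
under eq_fun do rewrite big_cons.
apply: cvgM; first by apply: F_cont; rewrite mem_head.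
by apply: IH => j jr; apply: F_cont; rewrite inE jr orbT.
Qed.

Context {n : nat}.
Implicit Types (a v w x y : 'rV[R]_n) (s : seq 'rV[R]_n).

Lemma dot_continuous a : continuous (dot a : 'rV[R]_n -> R).
Proof.
have -> : (dot a : 'rV[R]_n -> R) = (fun y => \sum_i a 0 i * y 0 i).
  by apply/funext => y; rewrite dotE.
move=> x; apply: sum_continuous_at => i _.
by apply: continuousM; [exact: cst_continuous|exact: coord_continuous].
Qed.

Lemma is_derive_dot a x v : is_derive x v (dot a : 'rV[R]_n -> R) (dot a v).
Proof.
apply/is_derive_line.
have -> : (fun t : R => dot a (t *: v + x)) = dot a v \*: id + cst (dot a x).
  by apply/funext => t; rewrite dotDr dotZr mulrC.
by apply: is_derive_eq; rewrite addr0 [LHS]mulr1.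
Qed.

(** A finite intersection of open half-spaces is open. This makes first-order formulas valid on a
    neighbourhood, so that they can be differentiated again. *)
Lemma near_dot_gt0 s x : (forall a, a \in s -> 0 < dot a x) ->
  \forall y \near x, forall a, a \in s -> 0 < dot a y.
Proof.
elim: s => [_|b s IH x_pos]; first by near=> y.
have near_s := IH (fun a aP => x_pos a (mem_behead (s := b :: s) aP)).
have near_b : \forall y \near x, 0 < dot b y.
  exact: (@dot_continuous b x _ (lt_nbhsr (x_pos b (mem_head b s)))).
near=> y => a; rewrite inE => /orP[/eqP ->|].
  by near: y.
by move: a; near: y.
Unshelve. all: by end_near. Qed.


(** * Calculus of products of powers of linear forms *)

Context (c : 'rV[R]_n -> R).

Definition powR_prod s y : R := \prod_(a <- s) (dot a y `^ c a).

Definition log_deriv s v y : R := \sum_(a <- s) c a * (dot a v / dot a y).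

(** Minus the second derivative, along [v] and [w], of the logarithm of [powR_prod] where all the
    linear forms are positive. *)
Definition log_deriv2 s v w y : R :=
  \sum_(a <- s) c a * (dot a v * dot a w / dot a y ^+ 2).

Lemma is_derive_powR_prod s x v : (forall a, a \in s -> 0 < dot a x) ->
  is_derive x v (powR_prod s) (powR_prod s x * log_deriv s v x).
Proof.
elim: s => [_|b s IH x_pos].
  have -> : powR_prod [::] = cst 1.
    by apply/funext => y; rewrite /powR_prod big_nil.
  by rewrite /log_deriv big_nil mulr0; exact: is_derive_cst.
have {}IH := IH (fun a aP => x_pos a (mem_behead (s := b :: s) aP)).
have Bx := x_pos b (mem_head b s).
have -> : powR_prod (b :: s) = ((fun B => B `^ c b) \o dot b) * powR_prod s.
  by apply/funext => y; rewrite /powR_prod big_cons.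
have dB := is_derive_comp_scalar
  (is_derive1_powR (c b) Bx) (is_derive_dot b x v).
apply: is_derive_eq (is_deriveM dB IH) _.
rewrite /log_deriv big_cons /= -/(log_deriv s v x).
(* Splitting the exponent [c b - 1] makes the original power reappear, divided by [dot b x]. *)
rewrite powRB ?(gt_eqF Bx) ?implybT //.
rewrite powRr1 ?ltW //; set P := _ `^ _; set Q := powR_prod s x.
have B0 := lt0r_neq0 Bx.
change (P * (Q * log_deriv s v x) + Q * (c b * (P / dot b x) * dot b v) =
 P * Q * (c b * (dot b v / dot b x) + log_deriv s v x)).
by field.
Qed.

Lemma is_derive_log_deriv s x v w : (forall a, a \in s -> 0 < dot a x) ->
  is_derive x w (log_deriv s v) (- log_deriv2 s v w x).
Proof.
elim: s => [_|b s IH x_pos].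
  have -> : log_deriv [::] v = cst 0.
    by apply/funext => y; rewrite /log_deriv big_nil.
  by rewrite /log_deriv2 big_nil oppr0; exact: is_derive_cst.
have {}IH := IH (fun a aP => x_pos a (mem_behead (s := b :: s) aP)).
have Bx := lt0r_neq0 (x_pos b (mem_head b s)).
have -> : log_deriv (b :: s) v =
    (c b * dot b v) \*: ((fun B : R => B^-1) \o dot b) + log_deriv s v.
  by apply/funext => y; rewrite /log_deriv big_cons mulrA.
have dB := is_derive_comp_scalar
  (is_deriveV Bx (is_derive_id (dot b x : R) (1 : R))) (is_derive_dot b x w).
apply: is_derive_eq (is_deriveD (is_deriveZ (c b * dot b v) dB) IH) _.
rewrite /log_deriv2 big_cons -/(log_deriv2 s v w x) opprD; congr (_ - _).
change (c b * dot b v * (- (dot b x ^- 2) * 1 * dot b w) =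
  - (c b * (dot b v * dot b w / dot b x ^+ 2))).
by field.
Qed.

Lemma powR_prod_continuous s x : (forall a, a \in s -> 0 < dot a x) ->
  {for x, continuous (powR_prod s)}.
Proof.
move=> x_pos; apply: prod_continuous_at => a /x_pos ax.
apply: (@continuous_comp _ _ _ (dot a) (fun B : R => B `^ c a)).
  exact: dot_continuous.
apply: differentiable_continuous; apply/derivable1_diffP.
by have [] := is_derive1_powR (c a) ax.
Qed.

Lemma log_deriv_continuous s x v : (forall a, a \in s -> 0 < dot a x) ->
  {for x, continuous (log_deriv s v)}.
Proof.
move=> x_pos; apply: sum_continuous_at => a /x_pos /lt0r_neq0 ax.
apply: continuousM; first exact: cst_continuous.
apply: continuousM; first exact: cst_continuous.
by apply: continuousV => //; exact: dot_continuous.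
Qed.

Lemma log_deriv2_continuous s x v w : (forall a, a \in s -> 0 < dot a x) ->
  {for x, continuous (log_deriv2 s v w)}.
Proof.
move=> x_pos; apply: sum_continuous_at => a /x_pos /lt0r_neq0 ax.
apply: continuousM; first exact: cst_continuous.
apply: continuousM; first exact: cst_continuous.
apply: continuousV; first by rewrite expf_neq0.
by apply: continuousM; exact: dot_continuous.
Qed.

Lemma near_eq_continuous_at (T U : topologicalType) (f g : T -> U) (x : T) :
  (\forall y \near x, f y = g y) -> {for x, continuous f} ->
  {for x, continuous g}.
Proof.
move=> fg; rewrite /prop_for /= /continuous_at (nbhs_singleton fg) => f_cont.
apply: cvg_trans f_cont; apply: near_eq_cvg.
by apply: filterS fg => y ->.
Qed.

Lemma is_derive_powR_prod_log_deriv s x v w :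
  (forall a, a \in s -> 0 < dot a x) ->
  is_derive x w (powR_prod s * log_deriv s v)
    (powR_prod s x * (log_deriv s v x * log_deriv s w x - log_deriv2 s v w x)).
Proof.
move=> x_pos.
have dM := is_deriveM
  (is_derive_powR_prod w x_pos) (is_derive_log_deriv v w x_pos).
apply: is_derive_eq dM _.
rewrite [X in X + _ = _]mulrN [X in _ + X = _]mulrCA; ring.
Qed.

Lemma partial_powR_prod s x i : (forall a, a \in s -> 0 < dot a x) ->
  partial i (powR_prod s) x = powR_prod s x * log_deriv s (delta_mx 0 i) x.
Proof.
by move=> x_pos; have [_ <-] := is_derive_powR_prod (delta_mx 0 i) x_pos.
Qed.

Lemma near_partial_powR_prod s x i : (forall a, a \in s -> 0 < dot a x) ->
  \forall y \near x, (powR_prod s * log_deriv s (delta_mx 0 i)) y =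
    partial i (powR_prod s) y.
Proof.
move=> /near_dot_gt0; apply: filterS => y y_pos.
by rewrite partial_powR_prod.
Qed.

Lemma is_derive_partial_powR_prod s x i j :
  (forall a, a \in s -> 0 < dot a x) ->
  is_derive x (delta_mx 0 j) (partial i (powR_prod s))
    (powR_prod s x *
     (log_deriv s (delta_mx 0 i) x * log_deriv s (delta_mx 0 j) x -
      log_deriv2 s (delta_mx 0 i) (delta_mx 0 j) x)).
Proof.
move=> x_pos; apply: near_eq_is_derive; first exact: near_partial_powR_prod.
exact: is_derive_powR_prod_log_deriv.
Qed.

Lemma partial_partial_powR_prod s x i j : (forall a, a \in s -> 0 < dot a x) ->
  partial j (partial i (powR_prod s)) x = powR_prod s x *
     (log_deriv s (delta_mx 0 i) x * log_deriv s (delta_mx 0 j) x -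
      log_deriv2 s (delta_mx 0 i) (delta_mx 0 j) x).
Proof.
by move=> x_pos; have [_ <-] := is_derive_partial_powR_prod i j x_pos.
Qed.

Lemma C2_on_powR_prod s :
  C2_on [set x | forall a, a \in s -> 0 < dot a x] (powR_prod s).
Proof.
move=> x x_pos; split=> [|i]; first exact: powR_prod_continuous.
split=> [||j].
- by have [] := is_derive_powR_prod (delta_mx 0 i) x_pos.
- apply: near_eq_continuous_at; first exact: near_partial_powR_prod.
  apply: continuousM; first exact: powR_prod_continuous.
  exact: log_deriv_continuous.
- split; first by have [] := is_derive_partial_powR_prod i j x_pos.
  have near2 : \forall y \near x, powR_prod s y *
      (log_deriv s (delta_mx 0 i) y * log_deriv s (delta_mx 0 j) y -
       log_deriv2 s (delta_mx 0 i) (delta_mx 0 j) y) =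
      partial j (partial i (powR_prod s)) y.
    move: (near_dot_gt0 x_pos); apply: filterS => y y_pos.
    by rewrite partial_partial_powR_prod.
  apply: near_eq_continuous_at near2 _.
  apply: continuousM; first exact: powR_prod_continuous.
  apply: continuousB; last exact: log_deriv2_continuous.
  by apply: continuousM; exact: log_deriv_continuous.
Qed.

Lemma dot_gradient_powR_prod s x v : (forall a, a \in s -> 0 < dot a x) ->
  dot (gradient (powR_prod s) x) v = powR_prod s x * log_deriv s v x.
Proof.
move=> x_pos; rewrite dotE /log_deriv.
under eq_bigr do rewrite mxE partial_powR_prod // -mulrA mulr_suml.
rewrite -mulr_sumr exchange_big /=; congr (_ * _); apply: eq_bigr => a _.
rewrite (dotE a v) mulr_suml mulr_sumr; apply: eq_bigr => i _.
by rewrite dot_delta; ring.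
Qed.

(** With f the logarithm of the product, this is its Laplacian divided by itself, |grad f|^2 +
    Laplacian f. Summing over the coordinate directions turns the products of coordinates into dot
    products. *)
Lemma laplacian_powR_prod s x : (forall a, a \in s -> 0 < dot a x) ->
  laplacian (powR_prod s) x = powR_prod s x *
    (\sum_(a <- s) c a * (log_deriv s a x / dot a x) -
     \sum_(a <- s) c a * (dot a a / dot a x ^+ 2)).
Proof.
move=> x_pos; rewrite /laplacian.
under eq_bigr do rewrite partial_partial_powR_prod //.
rewrite -mulr_sumr sumrB; congr (_ * (_ - _)).
- rewrite /log_deriv; under eq_bigr do rewrite mulr_suml.
  rewrite exchange_big; apply: eq_bigr => a _ /=.
  under eq_bigr do rewrite mulr_sumr.
  rewrite exchange_big mulr_suml mulr_sumr; apply: eq_bigr => b _ /=.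
  rewrite (dotC b a) -(sum_dot_delta a b) mulr_suml mulr_sumr.
  by rewrite mulr_suml mulr_sumr; apply: eq_bigr => i _; ring.
- rewrite /log_deriv2 exchange_big; apply: eq_bigr => a _ /=.
  by rewrite -(sum_dot_delta a a) mulr_suml mulr_sumr; apply: eq_bigr => i _;
    ring.
Qed.

End DirectionalDerivatives.

Theorem lemma8 (R : realType) (n : nat) (Phi Phip : {fset 'rV[R]_n})
    (k : 'rV[R]_n -> R)
    (Phi_root : root_system Phi)
    (Phi_norm : normalized Phi)
    (Phip_pos : positive_subsystem Phi Phip)
    (k_ge0 : forall a, a \in Phi -> 0 <= k a)
    (k_inv : weyl_invariant Phi k) :
  harmonic_on (dunkl_laplacian Phip k) (chamber Phip) (delta Phip k).
Proof.
pose c a := 1 - 2 * k a.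
have c_inv : weyl_invariant Phi c by move=> w a wW aP; rewrite /c k_inv.
have chamberE x : chamber Phip x -> forall a, a \in Phip -> 0 < dot a x.
  by move=> xC a aP; rewrite dotC xC.
split=> [x /chamberE|x /chamberE x_pos]; first exact: (@C2_on_powR_prod _ _ c).
have x_neq0 a : a \in Phip -> dot a x != 0 by move=> /x_pos /lt0r_neq0.
rewrite /dunkl_laplacian -[delta Phip k]/(powR_prod c Phip).
rewrite laplacian_powR_prod //.
under [X in _ + X]eq_bigr do
  rewrite dot_gradient_powR_prod // (dotC x) -mulrA mulrCA.
rewrite -mulr_sumr mulrCA -mulrDr.
(* With [delta] factored out, the claim is that half of [S1 - S2], plus [S3], vanishes. *)
set S1 := \sum_(a <- _) _; set S2 := \sum_(a <- _) _; set S3 := \sum_(a <- _) _.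
have S2E : S2 = 2 * \sum_(a <- Phip) c a / dot a x ^+ 2.
  rewrite mulr_sumr /S2 big_seq [RHS]big_seq; apply: eq_bigr => a aP.
  by rewrite Phi_norm ?(positive_root Phip_pos) //; ring.
(* As [c a + 2 * k a] is 1, adding [2 * S3] removes the outer weight [c a] from [S1]; what is left
   is the double sum over positive roots weighted by [c b] alone. *)
have S13E : S1 + 2 * S3 = S2.
  rewrite S2E -(sum_pair_positive Phi_root Phi_norm Phip_pos c_inv x_neq0).
  rewrite mulr_sumr -big_split /=; apply: eq_bigr => a _.
  rewrite (_ : _ + _ = log_deriv c Phip a x / dot a x); last first.
    by rewrite /c; ring.
  rewrite /log_deriv mulr_suml; apply: eq_bigr => b _.
  by rewrite (dotC b a) invfM; ring.
have -> : 2^-1 * (S1 - S2) + S3 = 0 by rewrite -S13E; field.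
by rewrite mulr0.
Qed.
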